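(* Let $A\in\mathbb{R}^{n\times n}$ be symmetric with eigenvalues $\lambda_1>\lambda_2\ge\lambda_3\ge\cdots\ge\lambda_n$ and $\lambda_1>0$, and let $v_1$ be an eigenvector of $A$ for $\lambda_1$ with $\|v_1\|=1$. Let $f(x)=\|A-xx^\top\|_F^2$ for $x\in\mathbb{R}^n$. Then the local minimizers of $f$ are exactly $\sqrt{\lambda_1}\,v_1$ and $-\sqrt{\lambda_1}\,v_1$, and both of them are global minimizers of $f$.
   Context: $\|\cdot\|_F$ is the Frobenius norm and $\|\cdot\|$ the Euclidean norm of a vector. A point $y$ is a local minimizer of $f$ if there exists $\epsilon>0$ such that $f(y)\le f(x)$ for all $x$ with $\|x-y\|\le\epsilon$. *)

(* Defs.v *)
From mathcomp Require Import all_boot all_order all_algebra.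
From mathcomp Require Import reals.

Set Implicit Arguments.
Unset Strict Implicit.
Unset Printing Implicit Defensive.

Import Order.TTheory GRing.Theory Num.Theory.
Local Open Scope ring_scope.

(* The norm that MathComp-Analysis puts on matrices is the max norm, so the
   Euclidean and Frobenius norms are introduced here. *)
Definition norm2 (R : realType) (n : nat) (x : 'cV[R]_n) : R :=
  Num.sqrt (\sum_(i < n) x i 0 ^+ 2).

Definition normF (R : realType) (m n : nat) (M : 'M[R]_(m, n)) : R :=
  Num.sqrt (\sum_(i < m) \sum_(j < n) M i j ^+ 2).

Definition local_minimizer (R : realType) (n : nat)
    (f : 'cV[R]_n -> R) (y : 'cV[R]_n) : Prop :=
  exists eps : R, 0 < eps /\ forall x : 'cV[R]_n, norm2 (x - y) <= eps -> f y <= f x.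

Definition global_minimizer (R : realType) (n : nat)
    (f : 'cV[R]_n -> R) (y : 'cV[R]_n) : Prop :=
  forall x : 'cV[R]_n, f y <= f x.

(* Eigenvalues are listed with multiplicity, hence the characteristic
   polynomial; [lambda i] is the eigenvalue usually written with index i + 1. *)
Definition eigenvalues_of (R : realType) (n : nat)
    (A : 'M[R]_n) (lambda : 'I_n -> R) : Prop :=
  char_poly A = \prod_(i < n) ('X - (lambda i)%:P).

(* Column eigenvectors; [eigenspace] of mxalgebra consists of row vectors. *)
Definition eigenvector (R : realType) (n : nat)
    (A : 'M[R]_n) (a : R) (v : 'cV[R]_n) : Prop :=
  v != 0 /\ A *m v = a *: v.

Definition rank1_loss (R : realType) (n : nat) (A : 'M[R]_n) (x : 'cV[R]_n) : R :=
  normF (A - x *m x^T) ^+ 2.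

(* Main.v *)
Require Import Defs.
From mathcomp Require Import all_boot all_order all_algebra.
From mathcomp Require Import reals.
From mathcomp Require Import fingroup perm spectral complex ring lra.

Set Implicit Arguments.
Unset Strict Implicit.
Unset Printing Implicit Defensive.

Import Order.TTheory GRing.Theory Num.Theory.
Local Open Scope ring_scope.

(** Write x.y for the Euclidean inner product and l for the largest eigenvalue.
    Expanding the square gives f(x) = |A|_F^2 - 2 x.Ax + (x.x)^2
    ([rank1_lossE]).

    Global minimality: by the Rayleigh bound x.Ax <= l x.x ([dot_mul_le]),
    f(x) >= |A|_F^2 - l^2 + (x.x - l)^2 >= |A|_F^2 - l^2, and this value is
    attained at c v1 whenever c^2 = l.

    Necessity: along a line y + t d the loss is a quartic in t
    ([rank1_loss_line]), so a local minimizer y satisfies Ay = (y.y) y and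
    d.Ad <= (y.y)(d.d) + 2 (y.d)^2 for every d ([local_minimizer_critical]).
    If y.y were different from l, then y would be orthogonal to v1, eigenvectors
    for distinct eigenvalues being orthogonal; the second-order condition in the
    direction v1 would give y.y >= l > 0, and the Rayleigh bound at y would give
    y.y <= l. Hence y.y = l and y is an eigenvector for the simple eigenvalue l,
    so it is a multiple of v1 ([simple_eigenspace]) of squared length l.

    Both facts about the top eigenvalue come from diagonalizing A by a unitary
    matrix over the complex numbers ([symmetric_spectral]). *)

(** * Inner product and the expanded loss *)

Definition dot (R : realType) (n : nat) (x y : 'cV[R]_n) : R := (x^T *m y) 0 0.

Lemma dotE (R : realType) (n : nat) (x y : 'cV[R]_n) :
  dot x y = \sum_i x i 0 * y i 0.
Proof. by rewrite /dot mxE; apply: eq_bigr => i _; rewrite mxE. Qed.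

Lemma dotC (R : realType) (n : nat) (x y : 'cV[R]_n) : dot x y = dot y x.
Proof. by rewrite !dotE; apply: eq_bigr => i _; rewrite mulrC. Qed.

Lemma dotDr (R : realType) (n : nat) (x y z : 'cV[R]_n) :
  dot x (y + z) = dot x y + dot x z.
Proof. by rewrite /dot mulmxDr mxE. Qed.

Lemma dotZr (R : realType) (n : nat) (c : R) (x y : 'cV[R]_n) :
  dot x (c *: y) = c * dot x y.
Proof. by rewrite /dot -scalemxAr mxE. Qed.

Lemma dotDl (R : realType) (n : nat) (x y z : 'cV[R]_n) :
  dot (x + y) z = dot x z + dot y z.
Proof. by rewrite dotC dotDr !(dotC z). Qed.

Lemma dotZl (R : realType) (n : nat) (c : R) (x y : 'cV[R]_n) :
  dot (c *: x) y = c * dot x y.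
Proof. by rewrite dotC dotZr dotC. Qed.

Lemma dotxx_ge0 (R : realType) (n : nat) (x : 'cV[R]_n) : 0 <= dot x x.
Proof. by rewrite dotE; apply: sumr_ge0 => i _; rewrite -expr2 sqr_ge0. Qed.

Lemma dotxx_eq0 (R : realType) (n : nat) (x : 'cV[R]_n) : dot x x = 0 -> x = 0.
Proof.
rewrite dotE => /eqP; rewrite psumr_eq0 => [/allP x0|i _]; last first.
  by rewrite -expr2 sqr_ge0.
apply/colP => i; have := x0 i (mem_index_enum i).
by rewrite /= -expr2 sqrf_eq0 mxE => /eqP.
Qed.

Lemma norm2E (R : realType) (n : nat) (x : 'cV[R]_n) :
  norm2 x = Num.sqrt (dot x x).
Proof. by rewrite /norm2 dotE; congr Num.sqrt; apply: eq_bigr. Qed.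

Lemma dot_symmetric (R : realType) (n : nat) (A : 'M[R]_n) (x y : 'cV[R]_n) :
  A^T = A -> dot (A *m x) y = dot x (A *m y).
Proof. by move=> A_sym; rewrite /dot trmx_mul A_sym mulmxA. Qed.

Lemma rank1_lossE (R : realType) (n : nat) (A : 'M[R]_n) (x : 'cV[R]_n) :
  rank1_loss A x = normF A ^+ 2 - 2 * dot x (A *m x) + dot x x ^+ 2.
Proof.
have sum_sqr_ge0 (M : 'M[R]_n) : 0 <= \sum_i \sum_j M i j ^+ 2.
  by apply: sumr_ge0 => i _; apply: sumr_ge0 => j _; rewrite sqr_ge0.
rewrite /rank1_loss /normF !sqr_sqrtr //.
have -> : dot x (A *m x) = \sum_i \sum_j x i 0 * (A i j * x j 0).
  by rewrite dotE; apply: eq_bigr => i _; rewrite mxE mulr_sumr.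
have -> : dot x x ^+ 2 = \sum_i \sum_j x i 0 ^+ 2 * x j 0 ^+ 2.
  rewrite dotE expr2 mulr_suml; apply: eq_bigr => i _.
  by rewrite mulr_sumr; apply: eq_bigr => j _; rewrite -!expr2.
rewrite mulr_sumr -sumrB -big_split /=; apply: eq_bigr => i _.
rewrite mulr_sumr -sumrB -big_split /=; apply: eq_bigr => j _.
rewrite !mxE big_ord1 !mxE; ring.
Qed.

(** * Spectral facts *)

Lemma char_poly_conj (F : comUnitRingType) (n : nat) (P D : 'M[F]_n) :
  P \in unitmx -> char_poly (invmx P *m D *m P) = char_poly D.
Proof.
move=> P_unit; pose Q := map_mx polyC P; pose Q' := map_mx polyC (invmx P).
have QQ : Q' *m Q = 1%:M by rewrite -map_mxM mulVmx // map_mx1.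
have -> : char_poly (invmx P *m D *m P) = \det (Q' *m char_poly_mx D *m Q).
  rewrite /char_poly /char_poly_mx mulmxBr mulmxBl !map_mxM; congr (\det (_ - _)).
  by rewrite scalar_mxC -mulmxA QQ mulmx1.
by rewrite !det_mulmx mulrAC -det_mulmx QQ det1 mul1r.
Qed.

(** The complex vector z x consists of the coordinates of x in an orthonormal
    eigenbasis; the three properties kept here suffice to compute with inner
    products and with A. Comparing the characteristic polynomial of A with that
    of its diagonal form shows that the diagonal lists the given eigenvalues
    with the right multiplicities, up to the permutation s. *)
Lemma symmetric_spectral (R : realType) (n : nat) (A : 'M[R]_n)
    (lambda : 'I_n -> R) :
  A^T = A -> eigenvalues_of A lambda ->
  exists (z : 'cV[R]_n -> 'I_n -> R[i]) (s : 'S_n),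
    (forall x y, (dot x y)%:C%C = \sum_i (z x i)^* * z y i) /\
    (forall c x i, z (c *: x) i = c%:C%C * z x i) /\
    (forall x i, z (A *m x) i = (lambda (s i))%:C%C * z x i).
Proof.
move=> A_sym A_eig; pose toC := real_complex R; pose AC := map_mx toC A.
have AC_normal : AC \is normalmx.
  apply/normalmxP; suff -> : map_mx Num.conj AC^T = AC by [].
  apply/matrixP => i j; rewrite !mxE -{2}A_sym mxE.
  by apply/CrealP/complex_realP; exists (A j i).
have /orthomx_spectralP AC_E := AC_normal.
have P_unitary := spectral_unitarymx AC.
have P_unit := spectral_unit AC.
set P := spectralmx AC in AC_E P_unitary P_unit.
set d := spectral_diag AC in AC_E.
have : perm_eq [tuple d 0 i | i < n] [tuple toC (lambda i) | i < n].
  apply: prod_XsubC_eq; rewrite !big_map.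
  have := map_char_poly toC A; rewrite A_eig rmorph_prod.
  rewrite -/AC AC_E char_poly_conj // char_poly_trig; last first.
    exact: diag_mx_is_trig.
  rewrite -!enumT !big_enum /= => char_eq.
  transitivity (\prod_i ('X - (diag_mx d i i)%:P)).
    by apply: eq_bigr => i _; rewrite mxE eqxx mulr1n.
  rewrite -char_eq; apply: eq_bigr => i _.
  by rewrite /= rmorphB /= map_polyX map_polyC.
case/tuple_permP => s ds.
exists (fun x i => (P *m map_mx toC x) i 0), s; split=> [x y|].
  transitivity ((map_mx Num.conj (map_mx toC x)^T *m map_mx toC y) 0 0).
    rewrite !mxE dotE rmorph_sum; apply: eq_bigr => i _.
    rewrite !mxE rmorphM; congr (_ * _); apply/esym/CrealP/complex_realP.
    by exists (x i 0).
  have -> : map_mx Num.conj (map_mx toC x)^T *m map_mx toC y =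
      map_mx Num.conj (P *m map_mx toC x)^T *m (P *m map_mx toC y).
    rewrite trmx_mul map_mxM -mulmxA; congr (_ *m _).
    have := mulKmx P_unit (map_mx toC y); by rewrite invmx_unitary.
  by rewrite mxE; apply: eq_bigr => i _; rewrite !mxE.
split=> [c x i|x i]; first by rewrite map_mxZ -scalemxAr mxE.
rewrite map_mxM -/AC AC_E -!mulmxA mulKVmx // mul_diag_mx mxE; congr (_ * _).
have := congr1 (fun t : n.-tuple R[i] => tnth t i) (val_inj ds).
by rewrite !tnth_mktuple.
Qed.

(** In eigencoordinates x.Ax is the sum of the |z_i|^2 weighted by eigenvalues,
    and x.x is the unweighted sum. *)
Lemma dot_mul_le (R : realType) (n : nat) (A : 'M[R]_n)
    (lambda : 'I_n -> R) (k : 'I_n) (x : 'cV[R]_n) :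
  A^T = A -> eigenvalues_of A lambda ->
  (forall i, lambda i <= lambda k) ->
  dot x (A *m x) <= lambda k * dot x x.
Proof.
move=> A_sym A_eig lambda_le.
have [z [s [zE [_ zA]]]] := symmetric_spectral A_sym A_eig.
rewrite -lecR rmorphM /= !zE mulr_sumr; apply: ler_sum => i _.
by rewrite zA mulrCA ler_wpM2r ?lecR // mulrC -normCK exprn_ge0.
Qed.

(** Since the eigenvalue occurs once, all its eigenvectors live on one single
    eigencoordinate; two of them that are orthogonal cannot both be nonzero.
    This applies to v and to the part of x orthogonal to v. *)
Lemma simple_eigenspace (R : realType) (n : nat) (A : 'M[R]_n)
    (lambda : 'I_n -> R) (k : 'I_n) (v x : 'cV[R]_n) :
  A^T = A -> eigenvalues_of A lambda ->
  (forall i, i != k -> lambda i != lambda k) ->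
  dot v v = 1 -> A *m v = lambda k *: v -> A *m x = lambda k *: x ->
  x = dot v x *: v.
Proof.
move=> A_sym A_eig lambda_neq vv Av Ax.
have [z [s [zE [zZ zA]]]] := symmetric_spectral A_sym A_eig.
pose i0 := (s^-1)%g k.
have supp y i : A *m y = lambda k *: y -> i != i0 -> z y i = 0.
  move=> Ay ii0; have si : s i != k.
    by apply: contra_neq ii0 => si; rewrite /i0 -si permK.
  have := zA y i; rewrite Ay zZ => /eqP; rewrite -subr_eq0 -mulrBl mulf_eq0.
  case/orP => [|/eqP //]; rewrite -rmorphB /= => /eqP/complexI/eqP.
  by rewrite subr_eq0 eq_sym (negPf (lambda_neq _ si)).
have dot_supp y w : A *m y = lambda k *: y -> A *m w = lambda k *: w ->
    (dot y w)%:C%C = (z y i0)^* * z w i0.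
  move=> Ay Aw; rewrite zE (bigD1 i0) //= big1 ?addr0 // => i ii0.
  by rewrite (supp w) // mulr0.
pose u := x + (- dot v x) *: v.
have Au : A *m u = lambda k *: u.
  by rewrite mulmxDr -scalemxAr Av Ax scalerDr !scalerA mulrC.
have vu : dot v u = 0 by rewrite dotDr dotZr vv mulr1 subrr.
(* The product of the first two factors is v.v = 1, so z u i0 vanishes. *)
have : z v i0 * (z v i0)^* * z u i0 = 0.
  by rewrite -mulrA -dot_supp // vu mulr0.
rewrite [z v i0 * _]mulrC -dot_supp // vv mul1r => zu.
have /eqP : dot u u = 0 by apply: complexI; rewrite dot_supp // zu mulr0.
by move=> /eqP/dotxx_eq0/eqP; rewrite /u scaleNr subr_eq0 => /eqP.
Qed.

(** * Optimality conditions *)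

Lemma le0_linear_bound (R : realType) (e K delta : R) :
  0 <= K -> 0 < delta -> (forall t, 0 < t <= delta -> e <= K * t) -> e <= 0.
Proof.
move=> K_ge0 delta_gt0 e_le; rewrite leNgt; apply/negP => e_gt0.
have K1_gt0 : 0 < K + 1 by lra.
have q_gt0 : 0 < e / (K + 1) by rewrite divr_gt0.
(* K + 1 rather than K: it is nonzero, and K e / (K + 1) < e is strict. *)
have := e_le (Num.min delta (e / (K + 1))).
rewrite lt_min delta_gt0 q_gt0 ge_min lexx => /(_ isT).
apply/negP; rewrite -ltNge.
have : K * Num.min delta (e / (K + 1)) <= K * (e / (K + 1)).
  by rewrite ler_wpM2l // ge_min lexx orbT.
have : (K + 1) * (e / (K + 1)) = e by rewrite mulrC divfK ?gt_eqF.
lra.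
Qed.

(** First- and second-order conditions at 0, without differentiating: dividing
    p t >= 0 and p (- t) >= 0 by t, and their sum by t^2, leaves a bound by a
    multiple of t on |a1| and on - a2 respectively. *)
Lemma quartic_min (R : realType) (p : R -> R) (a1 a2 a3 a4 delta : R) :
  (forall t, p t = a1 * t + a2 * t ^+ 2 + a3 * t ^+ 3 + a4 * t ^+ 4) ->
  0 < delta -> (forall t, `|t| <= delta -> 0 <= p t) ->
  a1 = 0 /\ 0 <= a2.
Proof.
move=> pE delta_gt0 p_ge0.
have min_gt0 : 0 < Num.min delta 1 by rewrite lt_min delta_gt0 ltr01.
have p_ge0' t : 0 < t <= Num.min delta 1 ->
    [/\ 0 < t, t <= 1, 0 <= a1 * t + a2 * t ^+ 2 + a3 * t ^+ 3 + a4 * t ^+ 4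
      & 0 <= - a1 * t + a2 * t ^+ 2 - a3 * t ^+ 3 + a4 * t ^+ 4].
  rewrite le_min => /and3P[t_gt0 t_delta t_le1]; split=> //.
    by rewrite -pE; apply: p_ge0; rewrite gtr0_norm.
  have := p_ge0 (- t); rewrite normrN gtr0_norm // => /(_ t_delta).
  by rewrite pE; congr (0 <= _); ring.
have pow_le (a t : R) (m k : nat) : 0 < t -> t <= 1 ->
    a * t ^+ (m + k) <= `|a| * t ^+ m.
  move=> t_gt0 t_le1; apply: (le_trans (ler_norm _)).
  rewrite normrM ler_wpM2l // ger0_norm; last by rewrite exprn_ge0 ?ltW.
  by rewrite exprD ger_pMr ?exprn_gt0 // exprn_ile1 // ltW.
split.
  apply/eqP; rewrite -normr_le0.
  apply: (@le0_linear_bound _ _ (`|a2| + `|a3| + `|a4|) _ _ min_gt0).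
    by rewrite !addr_ge0.
  move=> t /p_ge0'[t_gt0 t_le1 pt pNt]; rewrite -(ler_pM2r t_gt0).
  have a2_le : a2 * t ^+ 2 <= `|a2| * t ^+ 2 := pow_le a2 t 2 0 t_gt0 t_le1.
  have a3_le : a3 * t ^+ 3 <= `|a3| * t ^+ 2 := pow_le a3 t 2 1 t_gt0 t_le1.
  have a3N_le : - a3 * t ^+ 3 <= `|- a3| * t ^+ 2 := pow_le _ t 2 1 t_gt0 t_le1.
  have a4_le : a4 * t ^+ 4 <= `|a4| * t ^+ 2 := pow_le a4 t 2 2 t_gt0 t_le1.
  by rewrite normrN in a3N_le; case: (ger0P a1) => _; nra.
rewrite -oppr_le0.
apply: (@le0_linear_bound _ _ `|a4| _ _ min_gt0) => // t.
move=> /p_ge0'[t_gt0 t_le1 pt pNt].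
have t2_gt0 : 0 < t ^+ 2 by rewrite exprn_gt0.
rewrite -(ler_pM2r t2_gt0).
have a4_le : a4 * t ^+ 4 <= `|a4| * t ^+ 3 := pow_le a4 t 3 1 t_gt0 t_le1.
nra.
Qed.

Lemma rank1_loss_line (R : realType) (n : nat) (A : 'M[R]_n)
    (y d : 'cV[R]_n) (t : R) : A^T = A ->
  rank1_loss A (y + t *: d) - rank1_loss A y =
    4 * dot d (dot y y *: y - A *m y) * t +
    2 * (dot y y * dot d d + 2 * dot y d ^+ 2 - dot d (A *m d)) * t ^+ 2 +
    4 * (dot y d * dot d d) * t ^+ 3 + dot d d ^+ 2 * t ^+ 4.
Proof.
move=> A_sym; rewrite !rank1_lossE mulmxDr -scalemxAr -scaleN1r.
rewrite !(dotDl, dotDr, dotZl, dotZr) -(dot_symmetric y d A_sym).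
rewrite (dotC (A *m y)) (dotC y d); ring.
Qed.

(** The linear coefficient along d is 4 d.((y.y) y - Ay); it vanishes for all d,
    in particular for d = (y.y) y - Ay, which is therefore 0. *)
Lemma local_minimizer_critical (R : realType) (n : nat) (A : 'M[R]_n)
    (y : 'cV[R]_n) :
  A^T = A -> local_minimizer (rank1_loss A) y ->
  A *m y = dot y y *: y /\
  forall d, dot d (A *m d) <= dot y y * dot d d + 2 * dot y d ^+ 2.
Proof.
move=> A_sym [eps [eps_gt0 y_min]].
have line_min d : dot d (dot y y *: y - A *m y) = 0 /\
    0 <= dot y y * dot d d + 2 * dot y d ^+ 2 - dot d (A *m d).
  (* Adding 1 keeps the bound on t meaningful when d = 0. *)
  have d1_gt0 : 0 < norm2 d + 1 by rewrite ltr_wpDl // sqrtr_ge0.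
  have delta_gt0 : 0 < eps / (norm2 d + 1) by rewrite divr_gt0.
  have [|] := quartic_min (fun t => rank1_loss_line y d t A_sym) delta_gt0.
    move=> t t_le; rewrite subr_ge0; apply: y_min.
    rewrite addrAC subrr add0r norm2E dotZl dotZr mulrA -expr2.
    rewrite sqrtrM ?sqr_ge0 // sqrtr_sqr -norm2E.
    move: t_le; rewrite ler_pdivlMr //; apply: le_trans.
    by rewrite ler_wpM2l // lerDl.
  move=> /eqP; rewrite mulf_eq0 pnatr_eq0 /= => /eqP ->.
  by rewrite pmulr_rge0.
split=> [|d]; last by rewrite -subr_ge0; have [] := line_min d.
have [/dotxx_eq0/eqP + _] := line_min (dot y y *: y - A *m y).
by rewrite subr_eq0 => /eqP.
Qed.

(** * Local and global minimizers *)

Theorem theorem2p7 (R : realType) (n : nat) (A : 'M[R]_n.+1)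
    (lambda : 'I_n.+1 -> R) (v1 : 'cV[R]_n.+1)
    (A_sym : A^T = A)
    (A_eig : eigenvalues_of A lambda)
    (lambda_sorted : forall i j : 'I_n.+1, (i <= j)%N -> lambda j <= lambda i)
    (lambda_gap : forall i : 'I_n.+1, nat_of_ord i = 1%N -> lambda i < lambda ord0)
    (lambda1_gt0 : 0 < lambda ord0)
    (v1_eig : eigenvector A (lambda ord0) v1)
    (v1_unit : norm2 v1 = 1) :
  (forall y : 'cV[R]_n.+1,
     local_minimizer (rank1_loss A) y <->
     (y = Num.sqrt (lambda ord0) *: v1 \/ y = - (Num.sqrt (lambda ord0) *: v1))) /\
  global_minimizer (rank1_loss A) (Num.sqrt (lambda ord0) *: v1) /\
  global_minimizer (rank1_loss A) (- (Num.sqrt (lambda ord0) *: v1)).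
Proof.
set l1 := lambda ord0; set v := v1.
have [_ Av] := v1_eig.
have vv : dot v v = 1.
  by rewrite -[LHS]sqr_sqrtr ?dotxx_ge0 // -norm2E v1_unit expr1n.
have Rayleigh x : dot x (A *m x) <= l1 * dot x x.
  by apply: dot_mul_le => // i; apply: lambda_sorted.
have lambda_neq i : i != ord0 -> lambda i != l1.
  move=> i_neq0; have i_gt0 : (0 < i)%N by rewrite lt0n.
  have one_lt : (1 < n.+1)%N by apply: leq_ltn_trans (ltn_ord i).
  rewrite lt_eqF //; apply: le_lt_trans (lambda_gap (Ordinal one_lt) erefl).
  exact: lambda_sorted.
have global c : c ^+ 2 = l1 -> global_minimizer (rank1_loss A) (c *: v).
  move=> c2 x; rewrite !rank1_lossE -scalemxAr Av !(dotZl, dotZr) vv.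
  rewrite !mulr1 !(mulrA c c) -!expr2 c2 -/l1.
  have := Rayleigh x; have := sqr_ge0 (dot x x - l1); nra.
have sqrt2 : Num.sqrt l1 ^+ 2 = l1 by rewrite sqr_sqrtr ?ltW.
have global_pos := global _ sqrt2.
have global_neg : global_minimizer (rank1_loss A) (- (Num.sqrt l1 *: v)).
  by rewrite -scaleNr; apply: global; rewrite sqrrN.
split=> // y; split=> [y_min|]; last first.
  by case=> ->; exists 1; split=> [|x _]; rewrite ?ltr01 //.
have [Ay second_order] := local_minimizer_critical A_sym y_min.
have yy : dot y y = l1.
  apply/eqP; apply: contraT => yy_neq.
  have vy : dot v y = 0.
    have := dot_symmetric v y A_sym; rewrite Av Ay dotZl dotZr => /eqP.
    by rewrite -subr_eq0 -mulrBl mulf_eq0 subr_eq0 eq_sym (negPf yy_neq) => /eqP.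
  have yy_ge : l1 <= dot y y.
    have := second_order v; rewrite Av dotZr vv (dotC y) vy -/l1; lra.
  have := Rayleigh y; rewrite Ay dotZr ler_pM2r; last exact: lt_le_trans yy_ge.
  by move=> yy_le; rewrite eq_le yy_le yy_ge in yy_neq.
rewrite yy in Ay.
have yE := simple_eigenspace A_sym A_eig lambda_neq vv Av Ay.
have /eqP : dot v y ^+ 2 = Num.sqrt l1 ^+ 2.
  by rewrite sqrt2 -yy {2 3}yE dotZl dotZr vv mulr1.
rewrite eqf_sqr {3 4}yE => /orP[]/eqP ->; first by left.
by right; rewrite scaleNr.
Qed.
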